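(* The system $\mathsf{AX}_{\text{add}}$ is sound and complete: a formula $\varphi\in\mathcal{L}_{\text{add}}$ is derivable in $\mathsf{AX}_{\text{add}}$ if and only if $\varphi$ is true in every probability model.
   Context: Fix a nonempty set $\mathsf{Prop}$ of proposition letters; $\sigma(\mathsf{Prop})$ is the set of Boolean combinations over $\mathsf{Prop}$. $T_{\text{add}}$ is the set of terms generated from $\mathbf{P}(\alpha)$, $\alpha\in\sigma(\mathsf{Prop})$, by the binary operation $+$. $\mathcal{L}_{\text{add}}$ is the set of Boolean combinations (via $\neg,\wedge$) of atoms $\mathsf{a}\succsim\mathsf{b}$, $\mathsf{a},\mathsf{b}\in T_{\text{add}}$. Abbreviations: $\mathsf{0}$ is $\mathbf{P}(\bot)$ with $\bot$ any Boolean contradiction; $\mathsf{a}\approx\mathsf{b}$ is $\mathsf{a}\succsim\mathsf{b}\wedge\mathsf{b}\succsim\mathsf{a}$. A model is $\mathfrak{M}=(\Omega,\mathcal{F},\mathbb{P},[\![\cdot]\!])$ with $(\Omega,\mathcal{F},\mathbb{P})$ a probability space and $[\![\cdot]\!]:\sigma(\mathsf{Prop})\to\wp(\Omega)$ a Boolean valuation with $[\![A]\!]\in\mathcal{F}$ for $A\in\mathsf{Prop}$; $\mathbf{P}(\alpha)^{\mathfrak{M}}=\mathbb{P}([\![\alpha]\!])$, $+$ is real addition, $\mathfrak{M}\models\mathsf{a}\succsim\mathsf{b}$ iff $\mathsf{a}^{\mathfrak{M}}\geq\mathsf{b}^{\mathfrak{M}}$, and Boolean connectives are evaluated as usual. $\mathsf{AX}_{\text{base}}$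 consists of: $\mathsf{Lin}$ (transitivity and comparability of $\succsim$: $\mathsf{a}\succsim\mathsf{b}\wedge\mathsf{b}\succsim\mathsf{c}\to\mathsf{a}\succsim\mathsf{c}$ and $\mathsf{a}\succsim\mathsf{b}\vee\mathsf{b}\succsim\mathsf{a}$); $\mathsf{Bool}$ (Boolean reasoning: all instances of propositional tautologies and modus ponens); $\mathsf{Dist}$ ($\mathbf{P}(\alpha)\succsim\mathbf{P}(\beta)$ whenever $\beta\to\alpha$ is a propositional tautology); $\mathsf{NonDeg}$ ($\neg\,\mathbf{P}(\bot)\succsim\mathbf{P}(\top)$). $\mathsf{AX}_{\text{add}}$ consists of $\mathsf{AX}_{\text{base}}$ together with all instances, for $\alpha,\beta\in\sigma(\mathsf{Prop})$ and terms $\mathsf{a},\dots,\mathsf{f}\in T_{\text{add}}$, of: $\mathsf{Add}$: $\mathbf{P}(\alpha)\approx\mathbf{P}(\alpha\wedge\beta)+\mathbf{P}(\alpha\wedge\neg\beta)$; $\mathsf{Assoc}$: $\mathsf{a}+(\mathsf{b}+\mathsf{c})\approx(\mathsf{a}+\mathsf{b})+\mathsf{c}$; $\mathsf{Comm}$: $\mathsf{a}+\mathsf{b}\approx\mathsf{b}+\mathsf{a}$; $\mathsf{Zero}$: $\mathsf{a}+\mathsf{0}\approx\mathsf{a}$; $\mathsf{2Canc}$: $(\mathsf{a}+\mathsf{e}\succsim\mathsf{c}+\mathsf{f}\wedge\mathsf{b}+\mathsf{f}\succsim\mathsf{d}+\mathsf{e})\to\mathsf{a}+\mathsf{b}\succsim\mathsf{c}+\mathsf{d}$;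 $\mathsf{Contr}$: $(\mathsf{a}+\mathsf{b}\succsim\mathsf{c}+\mathsf{d}\wedge\mathsf{d}\succsim\mathsf{b})\to\mathsf{a}\succsim\mathsf{c}$. *)

(* Defs.v *)
From mathcomp Require Import all_boot all_order all_algebra.
From mathcomp Require Import all_classical all_reals all_analysis.

Set Implicit Arguments.
Unset Strict Implicit.
Unset Printing Implicit Defensive.

Import Order.TTheory GRing.Theory Num.Theory.

Local Open Scope classical_set_scope.
Local Open Scope ring_scope.

(** Boolean combinations over a set of atoms, with primitive negation and
    conjunction.  They serve at two levels: as the events sigma(Prop) and, over
    comparisons of terms, as the formulas of the additive language. *)
Inductive bcomb (X : Type) : Type :=
| Atom of X
| Not of bcomb X
| And of bcomb X & bcomb X.

Definition Or (X : Type) (p q : bcomb X) : bcomb X := Not (And (Not p) (Not q)).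
Definition Imp (X : Type) (p q : bcomb X) : bcomb X := Not (And p (Not q)).

Fixpoint beval (X : Type) (v : X -> bool) (p : bcomb X) : bool :=
  match p with
  | Atom x => v x
  | Not q => ~~ beval v q
  | And q r => beval v q && beval v r
  end.

Definition tautology (X : Type) (p : bcomb X) : Prop :=
  forall v : X -> bool, beval v p = true.
Definition contradiction (X : Type) (p : bcomb X) : Prop :=
  forall v : X -> bool, beval v p = false.

Inductive term (A : Type) : Type :=
| Pr of bcomb A
| Plus of term A & term A.

Record comparison (A : Type) : Type :=
  Comparison { lhs : term A; rhs : term A }.

Definition formula (A : Type) : Type := bcomb (comparison A).

Definition Geq (A : Type) (a b : term A) : formula A := Atom (Comparison a b).
Definition Eqv (A : Type) (a b : term A) : formula A :=
  And (Geq a b) (Geq b a).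

(** There is no constant for falsum or truth: [Ax_NonDeg] and [Ax_Zero] range
    over all contradictions [bot] (and all tautologies [top]). *)
Inductive provable (A : Type) : formula A -> Prop :=
| Ax_Taut (phi : formula A) : tautology phi -> provable phi
| Rule_MP (phi psi : formula A) :
    provable (Imp phi psi) -> provable phi -> provable psi
| Ax_Trans (a b c : term A) :
    provable (Imp (And (Geq a b) (Geq b c)) (Geq a c))
| Ax_Comparable (a b : term A) :
    provable (Or (Geq a b) (Geq b a))
| Ax_Dist (alpha beta : bcomb A) :
    tautology (Imp beta alpha) -> provable (Geq (Pr alpha) (Pr beta))
| Ax_NonDeg (bot top : bcomb A) :
    contradiction bot -> tautology top ->
    provable (Not (Geq (Pr bot) (Pr top)))
| Ax_Add (alpha beta : bcomb A) :
    provable (Eqv (Pr alpha)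
      (Plus (Pr (And alpha beta)) (Pr (And alpha (Not beta)))))
| Ax_Assoc (a b c : term A) :
    provable (Eqv (Plus a (Plus b c)) (Plus (Plus a b) c))
| Ax_Comm (a b : term A) :
    provable (Eqv (Plus a b) (Plus b a))
| Ax_Zero (a : term A) (bot : bcomb A) :
    contradiction bot -> provable (Eqv (Plus a (Pr bot)) a)
| Ax_2Canc (a b c d e f : term A) :
    provable (Imp (And (Geq (Plus a e) (Plus c f))
                        (Geq (Plus b f) (Plus d e)))
                   (Geq (Plus a b) (Plus c d)))
| Ax_Contr (a b c d : term A) :
    provable (Imp (And (Geq (Plus a b) (Plus c d)) (Geq d b)) (Geq a c)).

Record prob_model (R : realType) (A : Type) : Type := ProbModel {
  pm_disp : measure_display;
  pm_space : measurableType pm_disp;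
  pm_prob : probability pm_space R;
  pm_val : bcomb A -> set pm_space;
  pm_val_not : forall p : bcomb A, pm_val (Not p) = ~` pm_val p;
  pm_val_and : forall p q : bcomb A,
    pm_val (And p q) = pm_val p `&` pm_val q;
  pm_val_measurable : forall x : A, measurable (pm_val (Atom x))
}.

Arguments pm_space {R A} M : rename.
Arguments pm_prob {R A} M : rename.
Arguments pm_val {R A} M p : rename.

(** [fine] is harmless here: a probability never takes an infinite value. *)
Fixpoint term_value (R : realType) (A : Type) (M : prob_model R A)
    (a : term A) : R :=
  match a with
  | Pr p => fine (pm_prob M (pm_val M p))
  | Plus b c => term_value M b + term_value M c
  end.

Definition models (R : realType) (A : Type) (M : prob_model R A)
    (phi : formula A) : Prop :=
  beval (fun c => term_value M (rhs c) <= term_value M (lhs c)) phi = true.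

(* Main.v *)
Require Import Defs.
From HB Require Import structures.
From mathcomp Require Import all_boot all_order all_algebra.
From mathcomp Require Import all_classical all_reals all_analysis.
From mathcomp Require Import ring lra.

(** Soundness holds axiom by axiom: each one is a propositional tautology or a
    fact of linear arithmetic about the reals, except for [Ax_Dist],
    [Ax_NonDeg], [Ax_Add] and [Ax_Zero], which rest on monotonicity,
    normalization and additivity of the probability ([soundness]).

    For completeness, write G |- p for derivability of [Imp G p].  By
    propositional reasoning it is enough to derive phi from every G that
    decides each comparison occurring in phi ([ded_split]).  On these
    comparisons such a G amounts to a finite system of linear inequalities,
    strict and non-strict, and two things can happen ([inconsistent_or_model]).

    - The system has a solution among the probability measures.  Then the
      system holds in a discrete model ([discrete_model]); phi is true there,
      and G decides every subformula of phi in the way this model does, so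
      G |- phi.
    - The system has no solution.  Then a combination of its inequalities with
      natural number coefficients, involving a strict one, has the same linear
      form on both sides.  Sums of inequalities can be formed inside the
      calculus, so G derives a strict inequality between two equal terms: it is
      inconsistent, and again G |- phi.

    Two ingredients make this precise.  First, terms become vectors of natural
    numbers.  Cut the space by the finitely many events E in play; every cell
    either lies inside or is disjoint from a given event of E, so every term
    over E is provably equal to a linear combination of the probabilities of
    the cells ([ded_eqv_lin]).  The coefficient at a cell counts the events of
    the term that hold at a point of the cell, which is also how the term is
    evaluated in a discrete model with one point per cell.  Second, the
    alternative between a solution and a certificate is Motzkin's transposition
    theorem, proved by Fourier-Motzkin elimination ([fourier_motzkin]).  It is
    stated for an arbitrary predicate K on inequalities that is closed under
    addition, in place of an explicit certificate, and is used with K meaning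
    derivable from G. *)

Set Implicit Arguments.
Unset Strict Implicit.
Unset Printing Implicit Defensive.

Import Order.TTheory GRing.Theory Num.Theory.

Local Open Scope classical_set_scope.
Local Open Scope ring_scope.

(** * Fourier-Motzkin elimination *)

Definition pos_if (F : realFieldType) (b : bool) (z : F) : bool :=
  if b then 0 < z else 0 <= z.

Lemma pos_if_pmul (F : realFieldType) (b : bool) (k z : F) :
  0 < k -> pos_if b (k * z) = pos_if b z.
Proof. by rewrite /pos_if => k0; rewrite pmulr_rgt0 ?pmulr_rge0. Qed.

Lemma exists_seq_max (F : realFieldType) (z : F) (s : seq F) :
  exists2 m, m \in z :: s & {in z :: s, forall y, y <= m}.
Proof.
elim: s z => [|y s IHs] z.
  by exists z; rewrite ?mem_head// => y; rewrite inE => /eqP ->.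
have [m m_in m_max] := IHs y.
have [le_zm|lt_mz] := lerP z m.
  exists m; first by rewrite inE m_in orbT.
  by move=> x; rewrite inE => /orP[/eqP->//|/m_max].
exists z; first exact: mem_head.
move=> x; rewrite inE => /orP[/eqP->//|/m_max le_xm].
exact: le_trans le_xm (ltW lt_mz).
Qed.

Lemma exists_seq_min (F : realFieldType) (z : F) (s : seq F) :
  exists2 m, m \in z :: s & {in z :: s, forall y, m <= y}.
Proof.
have [m + m_max] := exists_seq_max (- z) (map -%R s).
rewrite -(map_cons -%R) => /mapP[y y_in def_m].
exists y => // x x_in; rewrite -lerN2 -def_m.
by apply: m_max; rewrite -(map_cons -%R) map_f.
Qed.

(** The flag of a bound says whether it is strict.  The midpoint of the largest
    lower bound and the smallest upper bound meets all bounds, whatever their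
    flags: if those two coincide, no bound with that value can be strict. *)
Lemma exists_between (F : realFieldType) (lo up : seq (bool * F)) :
    {in lo & up, forall l u, pos_if (l.1 || u.1) (u.2 - l.2)} ->
  exists x, {in lo, forall l, pos_if l.1 (x - l.2)} /\
            {in up, forall u, pos_if u.1 (u.2 - x)}.
Proof.
case: lo up => [|l0 lo] [|u0 up] sep.
- by exists 0.
- have [m _ m_min] := exists_seq_min u0.2 (map snd up).
  exists (m - 1); split=> // u u_in.
  have := m_min u.2; rewrite -(map_cons snd) map_f// => /(_ isT).
  by rewrite /pos_if; case: ifP => _ ?; lra.
- have [m _ m_max] := exists_seq_max l0.2 (map snd lo).
  exists (m + 1); split=> // l l_in.
  have := m_max l.2; rewrite -(map_cons snd) map_f// => /(_ isT).
  by rewrite /pos_if; case: ifP => _ ?; lra.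
have [m m_in m_max] := exists_seq_max l0.2 (map snd lo).
have [k k_in k_min] := exists_seq_min u0.2 (map snd up).
move: m_in k_in; rewrite -!(map_cons snd) => /mapP[lm lm_in def_m].
move=> /mapP[uk uk_in def_k]; exists ((m + k) / 2); split.
- move=> l l_in; have := sep _ _ l_in uk_in; rewrite -def_k.
  have := m_max l.2; rewrite -(map_cons snd) map_f// => /(_ isT).
  by rewrite /pos_if; case: l.1; case: uk.1 => /= *; lra.
- move=> u u_in; have := sep _ _ lm_in u_in; rewrite -def_m.
  have := k_min u.2; rewrite -(map_cons snd) map_f// => /(_ isT).
  by rewrite /pos_if; case: u.1; case: lm.1 => /= *; lra.
Qed.

Definition dot (F : realFieldType) n (u : 'rV[int]_n) (x : 'I_n -> F) : F :=
  \sum_j (u 0 j)%:~R * x j.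

Definition tail n (u : 'rV[int]_n.+1) : 'rV[int]_n :=
  \row_j u 0 (lift ord0 j).

Lemma dot_recl (F : realFieldType) n (u : 'rV[int]_n.+1) (x : 'I_n.+1 -> F) :
  dot u x = (u 0 ord0)%:~R * x ord0 + dot (tail u) (fun j => x (lift ord0 j)).
Proof.
rewrite /dot big_ord_recl; congr (_ + _).
by apply: eq_bigr => j _; rewrite mxE.
Qed.

Lemma dot_lin2 (F : realFieldType) n (a b : int) (u v : 'rV[int]_n)
    (x : 'I_n -> F) :
  dot (a *: u + b *: v) x = a%:~R * dot u x + b%:~R * dot v x.
Proof.
rewrite /dot !mulr_sumr -big_split; apply: eq_bigr => j _ /=.
by rewrite !mxE rmorphD !rmorphM /= mulrDl !mulrA.
Qed.

(** The system [cs] lists vectors u, with a flag for strictness, standing for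
    the constraints [0 <= dot u x] and [0 < dot u x]; thus [K true 0] is the
    certificate that they entail 0 < 0.  By induction on the
    number of unknowns: a constraint whose leading coefficient is positive
    bounds the first unknown from below, one whose leading coefficient is
    negative bounds it from above, and each such pair has a combination with
    positive integer coefficients in which the first unknown cancels.  The
    combinations, together with the constraints free of the first unknown, form
    the reduced system; a solution of it leaves room for the first unknown by
    [exists_between], and a certificate for it is one for [cs].  The
    coefficients are integers because [K] is closed only under addition. *)
Lemma fourier_motzkin (F : realFieldType) n (K : bool -> 'rV[int]_n -> Prop)
    (cs : seq (bool * 'rV[int]_n)) :
    (forall b c u v, K b u -> K c v -> K (b || c) (u + v)) ->
    {in cs, forall c, K c.1 c.2} ->
  (exists x : 'I_n -> F, {in cs, forall c, pos_if c.1 (dot c.2 x)})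
  \/ K true 0.
Proof.
elim: n K cs => [|n IHn] K cs KD Kcs.
  have [/hasP[[b u] /Kcs /= Ku b_true]|/hasPn no_strict] := boolP (has fst cs).
    by right; rewrite /= in b_true; rewrite b_true [u]thinmx0 in Ku.
  left; exists (fun=> 0) => c /no_strict /negPf.
  by rewrite /pos_if /dot big_ord0 => ->; rewrite lexx.
have KZ b u k : 0 < k -> K b u -> K b (k *: u).
  case: k => [[|k]|//] // _ Ku.
  rewrite -[Posz _]intz scaler_int -pmulrn; elim: k => [//|k IHk].
  by rewrite mulrS -[b]orbb; apply: KD.
(* The constraints in [K] that are free of the first unknown. *)
pose K' b (w : 'rV[int]_n) :=
  exists u, [/\ tail u = w, u 0 ord0 = 0 & K b u].
pose flat := [seq c : bool * 'rV[int]_n.+1 <- cs | c.2 0 ord0 == 0].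
pose lower := [seq c : bool * 'rV[int]_n.+1 <- cs | 0 < c.2 0 ord0].
pose upper := [seq c : bool * 'rV[int]_n.+1 <- cs | c.2 0 ord0 < 0].
pose merge (c d : bool * 'rV[int]_n.+1) :=
  (c.1 || d.1, - d.2 0 ord0 *: c.2 + c.2 0 ord0 *: d.2).
pose cs' := [seq (c.1, tail c.2)
  | c <- flat ++ [seq merge c d | c <- lower, d <- upper]].
case: (IHn K' cs').
- move=> b c _ _ [u [<- u0 Ku]] [v [<- v0 Kv]]; exists (u + v).
  by split; [apply/rowP => j; rewrite !mxE|rewrite mxE u0 v0|apply: KD].
- move=> _ /mapP[c c_in ->] /=; exists c.2; split=> //.
    move: c_in; rewrite mem_cat mem_filter => /orP[/andP[/eqP]//|].
    by move=> /allpairsP[[d e] [_ _ ->]] /=; rewrite !mxE /=; ring.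
  move: c_in; rewrite mem_cat mem_filter => /orP[/andP[_ /Kcs]//|].
  move=> /allpairsP[[d e] [/=]]; rewrite !mem_filter.
  move=> /andP[d_gt0 /Kcs Kd] /andP[e_lt0 /Kcs Ke] -> /=.
  by apply: KD; apply: KZ; rewrite ?oppr_gt0.
- case=> y y_sol; left.
  pose bound (c : bool * 'rV[int]_n.+1) :=
    (c.1, - dot (tail c.2) y / (c.2 0 ord0)%:~R).
  have [l u|x0 [x0_lo x0_up]] :=
      @exists_between F (map bound lower) (map bound upper).
    move=> /mapP[c c_in ->] /mapP[d d_in ->] /=.
    have /y_sol /= : ((merge c d).1, tail (merge c d).2) \in cs'.
      by apply: map_f; rewrite mem_cat allpairs_f ?orbT.
    have -> : tail (- d.2 0 ord0 *: c.2 + c.2 0 ord0 *: d.2)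
        = - d.2 0 ord0 *: tail c.2 + c.2 0 ord0 *: tail d.2.
      by apply/rowP => j; rewrite !mxE.
    rewrite dot_lin2 rmorphN /=.
    move: c_in d_in; rewrite !mem_filter => /andP[c0 _] /andP[d0 _].
    move: c0 d0; rewrite -(ltr0z F) -(ltrz0 F).
    move: (c.2 0 ord0)%:~R (d.2 0 ord0)%:~R (dot _ _) (dot _ _) => p q s t.
    move=> p0 q0 cd.
    rewrite -(@pos_if_pmul _ _ (p * - q)) ?mulr_gt0 ?oppr_gt0//.
    by move: cd; congr pos_if; field; rewrite gt_eqF ?lt_eqF.
  pose x j := if unlift ord0 j is Some k then y k else x0.
  have dotx c : dot c x = (c 0 ord0)%:~R * x0 + dot (tail c) y.
    rewrite dot_recl /x unlift_none; congr (_ + _).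
    by apply: eq_bigr => j _; rewrite liftK.
  exists x => c c_in; rewrite dotx.
  have [c_lt0|c_gt0|c_eq0] := ltgtP (c.2 0 ord0) 0.
  + have /x0_up /= sol : bound c \in map bound upper.
      by rewrite map_f// mem_filter c_lt0.
    have c_ne0 : (c.2 0 ord0)%:~R != 0 :> F by rewrite intr_eq0 lt_eqF.
    move: sol; rewrite -(@pos_if_pmul _ _ (- (c.2 0 ord0)%:~R) (_ - x0));
      last by rewrite oppr_gt0 ltrz0.
    by congr pos_if; field.
  + have /x0_lo /= sol : bound c \in map bound lower.
      by rewrite map_f// mem_filter c_gt0.
    have c_ne0 : (c.2 0 ord0)%:~R != 0 :> F by rewrite intr_eq0 gt_eqF.
    move: sol; rewrite -(@pos_if_pmul _ _ (c.2 0 ord0)%:~R (x0 - _)) ?ltr0z//.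
    by congr pos_if; field.
  + rewrite c_eq0 mul0r add0r; apply: (y_sol (c.1, tail c.2)).
    apply: (map_f (fun c => (c.1, tail c.2))).
    by rewrite mem_cat mem_filter c_eq0 eqxx c_in.
- case=> u [ut u0 Ku]; right; congr (K true _): Ku.
  apply/rowP => j; rewrite mxE; have [k ->|->//] := unliftP ord0 j.
  by move/rowP: ut => /(_ k); rewrite !mxE.
Qed.

(** * Soundness *)

Section Soundness.
Variables (R : realType) (A : Type) (M : prob_model R A).

(** The valuation of a model is determined by the letters: a point of the space
    acts as the truth assignment of the letters it belongs to. *)
Lemma in_pm_valE (p : bcomb A) (w : pm_space M) :
  pm_val M p w <-> beval (fun x => `[< pm_val M (Atom x) w >]) p.
Proof.
elim: p => [x|p IHp|p IHp q IHq] /=.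
- by rewrite asboolE.
- by rewrite pm_val_not /= IHp; split=> /negP.
- by rewrite pm_val_and /= IHp IHq; split=> /andP.
Qed.

Lemma measurable_pm_val (p : bcomb A) : measurable (pm_val M p).
Proof.
elim: p => [x|p IHp|p IHp q IHq]; first exact: pm_val_measurable.
- by rewrite pm_val_not; apply: measurableC.
- by rewrite pm_val_and; apply: measurableI.
Qed.

Lemma pm_val_sub (p q : bcomb A) : tautology (Imp p q) ->
  pm_val M p `<=` pm_val M q.
Proof.
move=> pq w; rewrite !in_pm_valE => p_w.
by have := pq (fun x => `[< pm_val M (Atom x) w >]); rewrite /= p_w negbK.
Qed.

Lemma term_value_le (p q : bcomb A) : tautology (Imp p q) ->
  term_value M (Pr p) <= term_value M (Pr q).
Proof.
move=> /pm_val_sub pq; rewrite /= fine_le ?fin_num_measure//.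
- exact: measurable_pm_val.
- exact: measurable_pm_val.
- by apply: le_measure; rewrite ?inE//; apply: measurable_pm_val.
Qed.

Lemma term_value_contradiction (p : bcomb A) :
  contradiction p -> term_value M (Pr p) = 0.
Proof.
move=> p0; rewrite /=; suff -> : pm_val M p = set0 by rewrite measure0.
by apply/seteqP; split=> // w; rewrite in_pm_valE p0.
Qed.

Lemma term_value_tautology (p : bcomb A) :
  tautology p -> term_value M (Pr p) = 1.
Proof.
move=> p1; rewrite /=; suff -> : pm_val M p = setT by rewrite probability_setT.
by apply/seteqP; split=> // w _; rewrite in_pm_valE p1.
Qed.

Lemma term_value_split (p q : bcomb A) :
  term_value M (Pr p) =
  term_value M (Pr (And p q)) + term_value M (Pr (And p (Not q))).
Proof.
have mv := measurable_pm_val.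
rewrite /= -fineD ?fin_num_measure// !pm_val_and pm_val_not.
rewrite -measureU//; first by rewrite -setIUr setUv setIT.
- by apply: measurableI => //; apply: measurableC.
- by apply: measurableI => //; apply: measurableC.
- by rewrite setIACA setICr setI0.
Qed.

Lemma soundness (phi : formula A) : provable phi -> models M phi.
Proof.
rewrite /models; elim=> {phi} /=.
- by move=> phi; apply.
- by move=> phi psi _ + _ phi1; rewrite phi1 /= negbK.
- move=> a b c; apply/negP => /andP[/andP[le_ba le_cb]] /negP[].
  exact: le_trans le_ba.
- by move=> a b; rewrite -negb_or negbK; apply: le_total.
- move=> p q; exact: term_value_le.
- move=> bot top bot0 top1.
  rewrite -/(term_value M (Pr bot)) -/(term_value M (Pr top)).
  by rewrite (term_value_contradiction bot0) (term_value_tautology top1) ler10.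
- by move=> p q; have /= -> := term_value_split p q; rewrite lexx.
- by move=> a b c; rewrite addrA lexx.
- by move=> a b; rewrite addrC lexx.
- move=> a bot bot0; rewrite -/(term_value M (Pr bot)).
  by rewrite term_value_contradiction// addr0 lexx.
- by move=> a b c d e f; apply/negP => /andP[/andP[? ?]] /negP[]; lra.
- by move=> a b c d; apply/negP => /andP[/andP[? ?]] /negP[]; lra.
Qed.
End Soundness.

(** * Terms as vectors *)

(** Letters may come from any type, so equality of events and of comparisons is
    decided classically; this makes membership in lists of them available. *)
HB.instance Definition _ (X : Type) := gen_eqMixin (bcomb X).
HB.instance Definition _ (A : Type) := gen_eqMixin (comparison A).

Fixpoint letters (X : Type) (p : bcomb X) : seq X :=
  match p with
  | Atom x => [:: x]
  | Not q => letters q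
  | And q r => letters q ++ letters r
  end.

Fixpoint events (A : Type) (a : term A) : seq (bcomb A) :=
  match a with
  | Pr p => [:: p]
  | Plus b c => events b ++ events c
  end.

(** The value of a term when all the mass sits on the truth assignment [v]. *)
Fixpoint mult (A : Type) (v : A -> bool) (a : term A) : nat :=
  match a with
  | Pr p => beval v p
  | Plus b c => mult v b + mult v c
  end.

(** * Derivations from a hypothesis *)

Section Deduction.
Variables (A : Type) (G : formula A).

Definition ded (p : formula A) : Prop := provable (Imp G p).

Lemma ded_provable p : provable p -> ded p.
Proof.
move=> pp; apply: Rule_MP pp; apply: Ax_Taut => v /=.
by case: (beval v p); case: (beval v G).
Qed.

Lemma ded_assumption : ded G.
Proof. by apply: Ax_Taut => v /=; case: (beval v G). Qed.

Lemma ded_mp p q : ded (Imp p q) -> ded p -> ded q.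
Proof.
move=> Gpq Gp; apply: Rule_MP Gp; apply: Rule_MP Gpq; apply: Ax_Taut => v /=.
by case: (beval v p); case: (beval v G); case: (beval v q).
Qed.

Lemma ded_taut p : tautology p -> ded p.
Proof. by move=> ?; apply/ded_provable/Ax_Taut. Qed.

Lemma ded_cons p q : (forall v, beval v p -> beval v q) -> ded p -> ded q.
Proof.
move=> pq; apply/ded_mp/ded_taut => v /=.
by apply/negP => /andP[/pq ->].
Qed.

Lemma ded_cons2 p q r :
  (forall v, beval v p -> beval v q -> beval v r) -> ded p -> ded q -> ded r.
Proof.
move=> pqr Gp; apply: ded_mp; apply: ded_cons Gp => v vp /=.
by apply/negP => /andP[/(pqr _ vp) ->].
Qed.

Lemma ded_and p q : ded p -> ded q -> ded (And p q).
Proof. by apply: ded_cons2 => v /= -> ->. Qed.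

Lemma ded_absurd p q : ded p -> ded (Not p) -> ded q.
Proof. by apply: ded_cons2 => v /= ->. Qed.

Definition ded_ge (a b : term A) : Prop := ded (Geq a b).
Definition ded_eqv (a b : term A) : Prop := ded_ge a b /\ ded_ge b a.

Lemma ded_ge_refl a : ded_ge a a.
Proof.
by apply: ded_cons (ded_provable (Ax_Comparable a a)) => v /=; case: (v _).
Qed.

Lemma ded_ge_trans b a c : ded_ge a b -> ded_ge b c -> ded_ge a c.
Proof.
by move=> ab bc; apply: ded_mp (ded_and ab bc); apply/ded_provable/Ax_Trans.
Qed.

Lemma ded_eqv_refl a : ded_eqv a a.
Proof. by split; apply: ded_ge_refl. Qed.

Lemma ded_eqv_sym a b : ded_eqv a b -> ded_eqv b a.
Proof. by case. Qed.

Lemma ded_eqv_trans b a c : ded_eqv a b -> ded_eqv b c -> ded_eqv a c.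
Proof.
move=> [ab ba] [bc cb]; split.
  exact: ded_ge_trans bc.
exact: ded_ge_trans ba.
Qed.

Lemma ded_ge_eqv a b a' b' :
  ded_eqv a a' -> ded_eqv b b' -> ded_ge a b -> ded_ge a' b'.
Proof.
by move=> [_ a'a] [bb' _] ab; apply: ded_ge_trans a'a (ded_ge_trans ab bb').
Qed.

Lemma ded_eqv_provable a b : provable (Eqv a b) -> ded_eqv a b.
Proof.
by move=> /ded_provable ab; split; apply: ded_cons ab => v /= /andP[].
Qed.

Lemma plusC a b : ded_eqv (Plus a b) (Plus b a).
Proof. exact/ded_eqv_provable/Ax_Comm. Qed.

Lemma plusA a b c : ded_eqv (Plus a (Plus b c)) (Plus (Plus a b) c).
Proof. exact/ded_eqv_provable/Ax_Assoc. Qed.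

Lemma ded_ge_events p q : tautology (Imp q p) -> ded_ge (Pr p) (Pr q).
Proof. by move=> qp; apply/ded_provable/Ax_Dist. Qed.

Lemma ded_eqv_events p q :
  (forall v, beval v p = beval v q) -> ded_eqv (Pr p) (Pr q).
Proof.
by move=> pq; split; apply: ded_ge_events => v /=; rewrite pq andbN.
Qed.

Lemma strict_ge a b : ded (Not (Geq a b)) -> ded_ge b a.
Proof.
apply: ded_cons2 (ded_provable (Ax_Comparable a b)) => v /=.
by case: (v _); case: (v _).
Qed.

Lemma strict_eqv a b a' b' :
  ded_eqv a a' -> ded_eqv b b' -> ded (Not (Geq a b)) -> ded (Not (Geq a' b')).
Proof.
move=> [aa' _] [_ b'b] ab.
have a'b'_ab : ded (Imp (Geq a' b') (Geq a b)).
  have := ded_provable (Ax_Trans a b' b).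
  have := ded_provable (Ax_Trans a a' b').
  move=> t1 /(ded_and t1)/(ded_and aa')/(ded_and b'b).
  apply: ded_cons => v /=.
  by do 5?case: (v _).
by apply: ded_cons2 ab a'b'_ab => v /= /negPf ->; case: (v _).
Qed.

(** Adding an inequality to a strict one gives a strict one: this is [Ax_Contr]
    read contrapositively. *)
Lemma strict_add a b c d :
  ded (Not (Geq b a)) -> ded_ge c d -> ded (Not (Geq (Plus b d) (Plus a c))).
Proof.
move=> ab cd; have := ded_provable (Ax_Contr b d a c).
move=> /(ded_and cd); apply: ded_cons2 ab => v /=.
by do 3?case: (v _).
Qed.

(** The language has no constant for zero; any contradictory event provides
    one. *)
Variable bot : bcomb A.
Hypothesis bot_false : contradiction bot.
Local Notation z := (Pr bot).

Lemma plusr0 a : ded_eqv (Plus a z) a.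
Proof. exact/ded_eqv_provable/Ax_Zero. Qed.

Lemma plus0r a : ded_eqv (Plus z a) a.
Proof. exact: ded_eqv_trans (plusC _ _) (plusr0 _). Qed.

(** Monotonicity of addition is the instance of [Ax_2Canc] in which both terms
    to be cancelled are zero. *)
Lemma ded_ge_add a b c d :
  ded_ge a c -> ded_ge b d -> ded_ge (Plus a b) (Plus c d).
Proof.
have add0 x y : ded_ge x y -> ded_ge (Plus x z) (Plus y z).
  by apply: ded_ge_eqv; apply/ded_eqv_sym/plusr0.
move=> /add0 ac /add0 bd; apply: ded_mp (ded_and ac bd).
exact/ded_provable/Ax_2Canc.
Qed.

Lemma ded_eqv_add a b c d :
  ded_eqv a c -> ded_eqv b d -> ded_eqv (Plus a b) (Plus c d).
Proof. by move=> [ac ca] [bd db]; split; apply: ded_ge_add. Qed.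

Lemma plusACA a b c d :
  ded_eqv (Plus (Plus a b) (Plus c d)) (Plus (Plus a c) (Plus b d)).
Proof.
apply: ded_eqv_trans (ded_eqv_sym (plusA _ _ _)) _.
apply: ded_eqv_trans (plusA _ _ _); apply: ded_eqv_add.
  exact: ded_eqv_refl.
apply: ded_eqv_trans (plusA _ _ _) _.
apply: ded_eqv_trans (ded_eqv_sym (plusA _ _ _)).
by apply: ded_eqv_add; [apply: plusC|apply: ded_eqv_refl].
Qed.

Lemma ded_ge_zero a : ded_ge a z.
Proof.
elim: a => [p|a IHa b IHb].
  by apply: ded_ge_events => v /=; rewrite bot_false.
by apply: ded_ge_eqv (ded_ge_add IHa IHb); [apply: ded_eqv_refl|apply: plusr0].
Qed.

Lemma ded_eqv_contradiction p : contradiction p -> ded_eqv (Pr p) z.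
Proof. by move=> p0; apply: ded_eqv_events => v; rewrite p0 bot_false. Qed.

Definition nmul (n : nat) (a : term A) : term A := iter n (Plus a) z.

Lemma nmul_add m n a : ded_eqv (Plus (nmul m a) (nmul n a)) (nmul (m + n) a).
Proof.
elim: m => [|m IHm]; first exact: plus0r.
apply: ded_eqv_trans (ded_eqv_sym (plusA _ _ _)) _.
by apply: ded_eqv_add IHm; apply: ded_eqv_refl.
Qed.

Local Notation "'\sum_t_' ( i <- r ) F" := (\big[@Plus A/z]_(i <- r) F)
  (at level 41, F at level 41, i, r at level 50).

(** * Cells of a finite family of events *)

(** The cells are the conjunctions that contain each event of [E] or its
    negation.  Contradictory ones are kept: they have probability zero and do
    no harm. *)
Fixpoint cells (E : seq (bcomb A)) : seq (bcomb A) :=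
  if E is p :: E' then
    flatten [seq [:: And c p; And c (Not p)] | c <- cells E']
  else [:: Not bot].

(** Each event added to [E] splits every summand in two, by [Ax_Add]. *)
Lemma ded_eqv_cells E p :
  ded_eqv (Pr p) (\big[@Plus A/z]_(c <- cells E) Pr (And c p)).
Proof.
elim: E => [|q E IHE] /=.
  rewrite big_cons big_nil; apply: ded_eqv_trans (ded_eqv_sym (plusr0 _)).
  by apply: ded_eqv_events => v /=; rewrite bot_false.
apply: ded_eqv_trans IHE _; elim: (cells E) => [|c cs IHcs] /=.
  by rewrite !big_nil; apply: ded_eqv_refl.
rewrite !big_cons; apply: ded_eqv_trans (ded_eqv_sym (plusA _ _ _)).
apply: ded_eqv_add IHcs.
apply: ded_eqv_trans (ded_eqv_provable (Ax_Add (And c p) q)) _.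
by apply: ded_eqv_add; apply: ded_eqv_events => v /=; rewrite andbAC.
Qed.

Lemma cells_decide E c p : c \in cells E -> p \in E ->
  tautology (Imp c p) \/ contradiction (And c p).
Proof.
elim: E c => [//|q E IHE] c /= /flatten_mapP[d d_in].
rewrite !inE => c_def /predU1P[p_q|p_in]; last first.
  have {IHE} [d_p|d_p] := IHE d d_in p_in; [left|right] => v;
    have := d_p v; case/orP: c_def => /eqP -> /=;
    by case: (beval v d); case: (beval v p); case: (beval v q).
by rewrite p_q; case/orP: c_def => /eqP -> /=; [left|right] => v /=;
  case: (beval v d); case: (beval v q).
Qed.

(** The value at a contradictory cell is arbitrary. *)
Definition witness (c : bcomb A) : A -> bool :=
  if pselect (exists v, beval v c) is left ex then projT1 (cid ex)
  else fun=> false.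

(** If [c] decides [p] then [And c p] amounts to [c] or to zero, and a single
    point of [c] tells which; when [c] is contradictory, both are zero. *)
Lemma ded_eqv_witness c p :
    tautology (Imp c p) \/ contradiction (And c p) ->
  ded_eqv (Pr (And c p)) (nmul (beval (witness c) p) (Pr c)).
Proof.
rewrite /witness; case: pselect => [ex|no_v] dec.
  case: cid => v /= v_c; case: dec => [c_p|cp0].
    have := c_p v; rewrite /= v_c negbK => -> /=.
    apply: ded_eqv_trans (ded_eqv_sym (plusr0 _)).
    apply: ded_eqv_events => w /=.
    by have /= := c_p w; case: (beval w c); case: (beval w p).
  by have := cp0 v; rewrite /= v_c /= => ->; apply: ded_eqv_contradiction.
have c0 v : beval v c = false by apply/negP => v_c; apply: no_v; exists v.
apply: (@ded_eqv_trans z).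
  by apply: ded_eqv_contradiction => v /=; rewrite c0.
case: beval => /=; last exact: ded_eqv_refl.
apply/ded_eqv_sym; apply: ded_eqv_trans (plusr0 _) _.
exact: ded_eqv_contradiction.
Qed.

Definition lin (N : nat) (c : 'I_N -> bcomb A) (m : 'I_N -> nat) : term A :=
  \big[@Plus A/z]_(i < N) nmul (m i) (Pr (c i)).

Lemma lin_add N (c : 'I_N -> bcomb A) m n :
  ded_eqv (Plus (lin c m) (lin c n)) (lin c (fun i => m i + n i)%N).
Proof.
rewrite /lin; elim/big_rec3: _ => [|i a b d _ IH]; first exact: plusr0.
apply: ded_eqv_trans (plusACA _ _ _ _) _.
by apply: ded_eqv_add IH; apply: nmul_add.
Qed.

(** Normal form: modulo derivable equality, a term over [E] depends only on its
    values at one point of each cell. *)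
Lemma ded_eqv_lin E
    (c := fun i : 'I_(size (cells E)) => nth bot (cells E) i) a :
    {subset events a <= E} ->
  ded_eqv a (lin c (fun i => mult (witness (c i)) a)).
Proof.
elim: a => [p|a IHa b IHb] /= a_E.
  apply: ded_eqv_trans (ded_eqv_cells E p) _.
  rewrite (big_nth bot) big_mkord /lin.
  elim/big_rec2: _ => [|i a b _ IH]; first exact: ded_eqv_refl.
  apply: ded_eqv_add IH; apply: ded_eqv_witness.
  by apply: (@cells_decide E); rewrite ?mem_nth ?a_E ?mem_head.
apply: ded_eqv_trans (lin_add _ _ _); apply: ded_eqv_add;
  [apply: IHa|apply: IHb]; move=> p p_in; apply: a_E;
  by rewrite mem_cat p_in ?orbT.
Qed.

End Deduction.

(** * Discrete models *)

(** Nonnegative weights with a positive sum, placed on points that carry given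
    truth assignments and normalized, make a model.  The space is the set of
    natural numbers, on which every set is measurable. *)
Lemma discrete_model (R : realType) (A : Type) (N : nat) (w : nat -> A -> bool)
    (x : 'I_N -> R) :
    (forall i, 0 <= x i) -> 0 < \sum_i x i ->
  exists M : prob_model R A, forall a,
    term_value M a = (\sum_i x i * (mult (w i) a)%:R) / \sum_i x i.
Proof.
move=> x_ge0 sx_gt0.
(* The weights, extended by zero beyond the given points. *)
pose y k := odflt 0 (omap x (insub k)).
have y_ge0 k : 0 <= y k by rewrite /y; case: insub => /=.
have yE (i : 'I_N) : y i = x i by rewrite /y valK.
pose mu : {measure set nat -> \bar R} :=
  msum (fun k => mscale (NngNum (y_ge0 k)) \d_k) N.
have muE (B : set nat) : mu B = (\sum_i x i * (nat_of_ord i \in B)%:R)%:E.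
  rewrite /mu /= /msum -sumEFin; apply: eq_bigr => i _.
  by rewrite -[LHS]/((y i)%:E * \d_(nat_of_ord i) B)%E diracE -EFinM yE.
have muT : mu setT = (\sum_i x i)%:E.
  by rewrite muE (eq_bigr x)// => i _; rewrite mem_setT mulr1.
(* The second argument is the value of [mnormalize] at a measure of total mass
   zero or infinity, which the positive sum excludes. *)
pose P : probability nat R := mnormalize mu \d_0%N.
have PE (B : set nat) :
    P B = ((\sum_i x i * (nat_of_ord i \in B)%:R) / \sum_i x i)%:E.
  by rewrite /P /= /mnormalize muT eqe gt_eqF//= muE.
have val_not p :
    [set k : nat | beval (w k) (Not p)] = ~` [set k | beval (w k) p].
  by apply/seteqP; split=> k /= /negP.
have val_and p q : [set k : nat | beval (w k) (And p q)]
    = [set k | beval (w k) p] `&` [set k | beval (w k) q].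
  by apply/seteqP; split=> k /= /andP.
exists (@ProbModel R A _ _ P _ val_not val_and (fun=> I)).
elim=> [p|a IHa b IHb] /=.
  by rewrite PE /=; congr (_ / _); apply: eq_bigr => i _; rewrite mem_setE.
rewrite IHa IHb -mulrDl -big_split; congr (_ / _); apply: eq_bigr => i _ /=.
by rewrite natrD mulrDr.
Qed.

(** * Completeness *)

(** The literals that [G] derives, read as linear inequalities on the weights of
    the cells, together with nonnegativity of the weights and positivity of
    their sum, form the system to which elimination applies.  The hypothesis
    [dec] turns the failure to derive a comparison into the derivability of its
    negation, which is a strict inequality. *)
Lemma inconsistent_or_model (R : realType) (A : Type) (bot : bcomb A)
    (G : formula A) (cs : seq (comparison A)) :
    contradiction bot ->
    {in cs, forall c, ded G (Atom c) \/ ded G (Not (Atom c))} ->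
  (forall p, ded G p) \/
  exists M : prob_model R A, {in cs, forall c,
    (ded G (Atom c) /\ term_value M (rhs c) <= term_value M (lhs c)) \/
    (ded G (Not (Atom c)) /\ term_value M (lhs c) < term_value M (rhs c))}.
Proof.
move=> bot0 dec.
(* The events [bot] and [Not bot] are included so that the positivity of the
   total weight is the inequality of [Ax_NonDeg]. *)
pose E := [:: bot, Not bot
  & flatten [seq events (lhs c) ++ events (rhs c) | c <- cs]].
pose N := size (cells bot E).
pose cell (i : 'I_N) := nth bot (cells bot E) i.
pose w k := witness (nth bot (cells bot E) k).
pose diff a b : 'rV[int]_N := \row_i ((mult (w i) a)%:Z - (mult (w i) b)%:Z).
(* The vector [u] comes from an inequality between combinations of cells that
   [G] derives, strictly if [s] holds. *)
pose K (s : bool) (u : 'rV[int]_N) := exists m m' : 'I_N -> nat,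
  [/\ u = \row_i ((m i)%:Z - (m' i)%:Z),
      ded_ge G (lin bot cell m) (lin bot cell m')
    & s -> ded G (Not (Geq (lin bot cell m') (lin bot cell m)))].
have linE := ded_eqv_lin G bot0.
have KD s t u v : K s u -> K t v -> K (s || t) (u + v).
  move=> [m [m' [-> mm' sm]]] [n [n' [-> nn' tn]]].
  exists (fun i => m i + n i)%N, (fun i => m' i + n' i)%N; split.
  - by apply/rowP => i; rewrite !mxE !PoszD; ring.
  - by apply: ded_ge_eqv (ded_ge_add bot0 mm' nn'); apply: lin_add.
  have addE := lin_add G bot0 cell.
  case: s sm => [/(_ isT) m'm _|_ /= /tn n'n].
    by apply: strict_eqv (addE _ _) (addE _ _) (strict_add m'm nn').
  apply: strict_eqv _ _ (strict_add n'n mm').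
    exact: ded_eqv_trans (plusC _ _ _) (addE _ _).
  exact: ded_eqv_trans (plusC _ _ _) (addE _ _).
have Kdiff (s : bool) a b : {subset events a <= E} -> {subset events b <= E} ->
    ded_ge G a b -> (s -> ded G (Not (Geq b a))) -> K s (diff a b).
  move=> /linE aE /linE bE ab sba.
  exists (fun i => mult (w i) a), (fun i => mult (w i) b).
  by split=> // [|/sba]; [apply: ded_ge_eqv ab|apply: strict_eqv].
have events_E c : c \in cs ->
    {subset events (lhs c) <= E} /\ {subset events (rhs c) <= E}.
  move=> c_in; split=> p p_in; rewrite !inE; apply/orP; right; apply/orP; right;
    by apply/flatten_mapP; exists c; rewrite // mem_cat p_in ?orbT.
pose nonneg : seq (bool * 'rV[int]_N) :=
  [seq (false, \row_j (j == i)%:Z) | i <- enum 'I_N].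
pose total := (true, diff (Pr (Not bot)) (Pr bot)).
pose literal c := if `[< ded G (Atom c) >] then (false, diff (lhs c) (rhs c))
                  else (true, diff (rhs c) (lhs c)).
have Kcs : {in nonneg ++ total :: map literal cs, forall d, K d.1 d.2}.
  move=> d; rewrite mem_cat inE => /orP[/mapP[i _ ->]|/predU1P[->|]] /=.
  - exists (fun j => (j == i) : nat), (fun=> 0%N); split=> //.
      by apply/rowP => j; rewrite !mxE subr0.
    rewrite /lin; elim/big_rec2: _ => [|j a b _ IH]; first exact: ded_ge_refl.
    by apply: (ded_ge_add bot0) IH; apply: ded_ge_zero.
  - apply: Kdiff.
    + by move=> p; rewrite mem_seq1 => /eqP ->; rewrite in_cons mem_head orbT.
    + by move=> p; rewrite mem_seq1 => /eqP ->; apply: mem_head.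
    + exact: ded_ge_zero.
    + move=> _; apply/ded_provable/Ax_NonDeg => // v /=.
      by rewrite bot0.
  - move=> /mapP[c c_in ->]; have [lE rE] := events_E c c_in.
    have := dec c c_in; rewrite /literal; case: asboolP => [Gc _|nGc [//|Gc]].
      by apply: Kdiff => //; case: c Gc {lE rE c_in}.
    by case: c Gc lE rE {c_in nGc} => a b /= Gc ? ?; apply: Kdiff => //;
      apply: strict_ge.
have [[x x_sol]|[m [m' [mm' _ /(_ isT) strict]]]] :=
    @fourier_motzkin R N K _ KD Kcs; last first.
  (* A strict inequality whose vector is zero compares a term with itself. *)
  left => p; apply: ded_absurd strict.
  rewrite (_ : lin _ _ m' = lin bot cell m).
    exact: ded_ge_refl.
  apply: eq_bigr => i _; congr (nmul _ _ _); apply/eqP.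
  move/rowP: mm' => /(_ i); rewrite !mxE => /esym/eqP.
  by rewrite subr_eq0 eqz_nat eq_sym.
right.
have dot_diff a b : dot (diff a b) x =
    \sum_i x i * (mult (w i) a)%:R - \sum_i x i * (mult (w i) b)%:R.
  rewrite -sumrB /dot; apply: eq_bigr => i _.
  by rewrite mxE rmorphB /= mulrBl -!pmulrn ![_ * x i]mulrC.
have x_ge0 i : 0 <= x i.
  have /x_sol : (false, \row_j (j == i)%:Z)
      \in nonneg ++ total :: map literal cs.
    by rewrite mem_cat (map_f (fun i => (false, \row_j (j == i)%:Z))) ?mem_enum.
  rewrite /pos_if /= /dot (bigD1 i)//= mxE eqxx mul1r big1 ?addr0// => j ji.
  by rewrite mxE (negPf ji) mul0r.
have sx_gt0 : 0 < \sum_i x i.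
  have /x_sol : total \in nonneg ++ total :: map literal cs.
    by rewrite mem_cat mem_head orbT.
  rewrite /pos_if /= dot_diff [X in _ - X]big1 => [|i _]; last first.
    by rewrite /= bot0 mulr0.
  by rewrite subr0; congr (0 < _); apply: eq_bigr => i _; rewrite /= bot0 mulr1.
have [M ME] := discrete_model w x_ge0 sx_gt0; exists M => c c_in.
have /x_sol : literal c \in nonneg ++ total :: map literal cs.
  by rewrite mem_cat inE map_f ?orbT.
rewrite !ME /literal; case: asboolP => [Gc|nGc] /=; rewrite /pos_if /= dot_diff.
  by rewrite subr_ge0 => le_x; left; rewrite ler_pM2r ?invr_gt0.
rewrite subr_gt0 => lt_x; right; rewrite ltr_pM2r ?invr_gt0//; split=> //.
by case: (dec c c_in).
Qed.

(** The comparisons of [cs] are decided one after another, by cases. *)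
Lemma ded_split (A : Type) (phi G : formula A) (cs : seq (comparison A)) :
    (forall H, ded H G ->
      {in cs, forall c, ded H (Atom c) \/ ded H (Not (Atom c))} -> ded H phi) ->
  ded G phi.
Proof.
elim: cs G => [|c cs IHcs] G dec_phi.
  by apply: dec_phi => //; apply: ded_assumption.
have case_c l : l = Atom c \/ l = Not (Atom c) -> ded (And G l) phi.
  move=> l_c; apply: IHcs => H HGl dec; apply: dec_phi.
    by apply: ded_cons HGl => v /= /andP[].
  move=> d; rewrite inE => /predU1P[->|/dec//].
  have Hl : ded H l by apply: ded_cons HGl => v /= /andP[].
  by case: l_c Hl => ->; [left|right].
have Gc := case_c _ (or_introl erefl); have Gnc := case_c _ (or_intror erefl).
apply: Rule_MP Gnc; apply: Rule_MP Gc; apply: Ax_Taut => v /=.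
by case: (beval v G); case: (beval v phi); case: (v c).
Qed.

Lemma completeness (R : realType) (A : Type) (bot : bcomb A) (phi : formula A) :
    contradiction bot -> (forall M : prob_model R A, models M phi) ->
  provable phi.
Proof.
move=> bot0 phi_true; pose top : formula A := Or phi (Not phi).
have topT : tautology top by move=> v /=; rewrite negbK andNb.
suff: ded top phi by move/Rule_MP; apply; apply: Ax_Taut.
apply: (@ded_split _ _ _ (letters phi)) => G _ dec.
have [//|[M M_lit]] := inconsistent_or_model R bot0 dec.
(* [G] agrees with the model on the literals, hence on all subformulas. *)
have truth psi : {subset letters psi <= letters phi} ->
    ded G (if beval (fun c => term_value M (rhs c) <= term_value M (lhs c)) psi
           then psi else Not psi).
  elim: psi => [c|p IHp|p IHp q IHq] /= psi_phi.
  - have [|[Gc ->//]|[Gnc]] := M_lit c; first by rewrite psi_phi ?mem_head.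
    by rewrite ltNge => /negPf ->.
  - have := IHp psi_phi; case: beval => //=.
    by apply: ded_cons => v /= ->.
  - have := IHq _; have := IHp _; case: beval; case: beval => /= Gp Gq.
    + apply: ded_and; [apply: Gp|apply: Gq] => c c_in; apply: psi_phi;
        by rewrite mem_cat c_in ?orbT.
    + apply: ded_cons (Gq _) => [v /= /negPf ->|c c_in]; first by rewrite andbF.
      by apply: psi_phi; rewrite mem_cat c_in orbT.
    + apply: ded_cons (Gp _) => [v /= /negPf ->//|c c_in].
      by apply: psi_phi; rewrite mem_cat c_in.
    + apply: ded_cons (Gp _) => [v /= /negPf ->//|c c_in].
      by apply: psi_phi; rewrite mem_cat c_in.
by have := truth phi; rewrite phi_true; apply.
Qed.

Theorem theorem2 (R : realType) (A : Type) (A_nonempty : inhabited A)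
    (phi : formula A) :
  provable phi <-> (forall M : prob_model R A, models M phi).
Proof.
split=> [phi_prov M|]; first exact: soundness.
case: A_nonempty => x; apply: (@completeness R A (And (Atom x) (Not (Atom x)))).
by move=> v /=; rewrite andbN.
Qed.
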